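(* Consider a scalar ODE $\dot x(t)=f(x(t))$, $x(a)=\eta$, on the time interval $[a,b]$, with solution $x$. Suppose that the polynomial $p=p_{J,K}^*$ (the weak-SINDy approximation of $f$ defined in the context) satisfies $$\|f\circ x - p\circ x\|_{L^2([a,b])}\leq \varepsilon$$ for some $\varepsilon>0$. Let $\hat x:[a,b]\to X$ be a solution of $\dot{\hat x}(t)=p(\hat x(t))$, $\hat x(a)=\eta$. Let $[a,\beta]\subseteq[a,b]$ and let $L_{[a,\beta]}$ denote the Lipschitz constant of $p$ on the time interval $[a,\beta]$, i.e. the Lipschitz constant of $p$ on the set of values taken by $x$ and $\hat x$ on $[a,\beta]$. Suppose that $[a,\beta]$ is sufficiently small that $(\beta-a)L_{[a,\beta]}<1$. Then $$\|x-\hat{x}\|_{L^\infty ([a, \beta])}\leq \frac{(\beta-a)^{1/2}}{1-(\beta-a) L_{[a,\beta]}}\,\varepsilon .$$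
   Context: $[a,b]$ is a compact interval, $f:X\to\mathbb{R}$, and $X=x([a,b])$ is the range of the solution $x:[a,b]\to\mathbb{R}$ (assumed bounded). $\mathbb{P}_J(X)$ is the space of real polynomials of degree at most $J$ on $X$, with basis $\varphi_0,\dots,\varphi_J$; $\mathbb{P}_K([a,b])$ is the space of real polynomials of degree at most $K$ on $[a,b]$, with an $L^2([a,b])$-orthonormal basis $\psi_0,\dots,\psi_K$. $\mathcal{P}_K$ is the $L^2([a,b])$-orthogonal projection onto $\mathbb{P}_K([a,b])$. Standing assumption: the $(K+1)\times(J+1)$ matrix $\bm{G}$ with entries $\bm{G}_{k,j}=\langle \varphi_j\circ x,\psi_k\rangle_{L^2([a,b])}$ has full column rank. Then $p_{J,K}^* := \operatorname*{argmin}_{p\in\mathbb{P}_J(X)}\|\mathcal{P}_K (f\circ x - p \circ x)\|_{L^2([a,b])}$ is uniquely defined. *)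

(* Defs.v *)
From HB Require Import structures.
From mathcomp Require Import all_boot all_order all_algebra.
From mathcomp Require Import all_classical all_reals all_analysis.

Set Implicit Arguments.
Unset Strict Implicit.
Unset Printing Implicit Defensive.

Import Order.TTheory GRing.Theory Num.Theory.
Import numFieldNormedType.Exports.

Local Open Scope classical_set_scope.
Local Open Scope ring_scope.

(* Functions on [a, b] are represented by total functions R -> R of which only
   the values on [a, b] are used.  The space of real polynomials of degree at
   most n is the vector space {poly_n.+1 R} of polynomials of size <= n.+1. *)

Section WeakSINDy.
Variable R : realType.

(* The restriction g \_ `[a, b] extends g by 0 outside [a, b]. *)
Definition Lpnorm (p : \bar R) (a b : R) (g : R -> R) : \bar R :=
  'N[@lebesgue_measure R]_p[EFin \o (g \_ `[a, b])]%E.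

Definition L2dot (a b : R) (g h : R -> R) : R :=
  \int[@lebesgue_measure R]_(t in `[a, b]) (g t * h t).

(* The L^2([a, b])-orthogonal projection of g onto the polynomials of degree at
   most K: the polynomial q such that g - q is orthogonal to all of them.  For
   a < b and g in L^2([a, b]) it exists and is unique; xget selects it. *)
Definition poly_proj (K : nat) (a b : R) (g : R -> R) : {poly_K.+1 R} :=
  xget 0 [set q : {poly_K.+1 R} | forall r : {poly_K.+1 R},
            L2dot a b (fun t => g t - (q : {poly R}).[t])
                      (fun t => (r : {poly R}).[t]) = 0].

Definition wsindy_mx (J K : nat) (a b : R) (x : R -> R)
    (phi : J.+1.-tuple {poly_J.+1 R}) (psi : K.+1.-tuple {poly_K.+1 R}) :
    'M[R]_(K.+1, J.+1) :=
  \matrix_(k < K.+1, j < J.+1)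
    L2dot a b (fun t => (tnth phi j : {poly R}).[x t])
              (fun t => (tnth psi k : {poly R}).[t]).

Definition orthonormal_polys (K : nat) (a b : R)
    (psi : K.+1.-tuple {poly_K.+1 R}) : Prop :=
  forall k l : 'I_K.+1,
    L2dot a b (fun t => (tnth psi k : {poly R}).[t])
              (fun t => (tnth psi l : {poly R}).[t]) = (k == l)%:R.

Definition wsindy_residual (J K : nat) (a b : R) (f x : R -> R)
    (p : {poly_J.+1 R}) : \bar R :=
  Lpnorm 2%:E a b (fun t =>
    (poly_proj K a b (fun s => f (x s) - (p : {poly R}).[x s]) : {poly R}).[t]).

(* p is an argmin of the residual; the argmin is unique when wsindy_mx
   has full column rank and f \o x is in L^2([a, b]). *)
Definition is_wsindy_approx (J K : nat) (a b : R) (f x : R -> R)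
    (p : {poly_J.+1 R}) : Prop :=
  forall q : {poly_J.+1 R},
    (wsindy_residual K a b f x p <= wsindy_residual K a b f x q)%E.

(* Classical solutions, with the equation required in the open interval and
   continuity up to the endpoints; solutions that also satisfy the equation at
   the endpoints, with one-sided derivatives, are a special case. *)
Definition ode_solution (F : R -> R) (eta a b : R) (y : R -> R) : Prop :=
  [/\ y a = eta,
      {within `[a, b], continuous y} &
      forall t, t \in `]a, b[ -> is_derive t (1 : R) y (F (y t))].

(* The least Lipschitz constant of g on A. *)
Definition lipschitz_constant (A : set R) (g : R -> R) : R :=
  inf [set k : R | 0 <= k /\ k.-lipschitz_A g].

End WeakSINDy.

(* Main.v *)
Require Import Defs.
From HB Require Import structures.
From mathcomp Require Import all_boot all_order all_algebra.
From mathcomp Require Import all_classical all_reals all_analysis.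
From mathcomp Require Import measurable_realfun ess_sup_inf ring lra.
Import Order.TTheory GRing.Theory Num.Theory.
Import numFieldNormedType.Exports.
Local Open Scope classical_set_scope.
Local Open Scope ring_scope.

(** The error [E = x - xhat] vanishes at [a] and is differentiable everywhere on
the open interval, with [|E'| <= |f \o x - p \o x| + L * M] where
[M = max |E|] on [[a, beta]].  Integrating up to a point where [|E|] is maximal
and bounding the first term by Cauchy-Schwarz gives
[M <= sqrt (beta - a) * eps + (beta - a) * L * M].

As [f] is arbitrary, [x'] is merely a derivative, so the integration step needs
the fact that [F b - F a] is at most the integral of any nonnegative measurable
[h] with [F' <= h] everywhere.  For this, cover each level set
[n d <= h < (n + 1) d] tightly by an open set [U n] and compare [F] with
[t |-> \sum_n (n + 1) d mu (U n `&` ]a, t])]: to the right of every point the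
latter grows locally at least as fast as [F]. *)

(** * Bounding increments by integrals of one-sided majorants of the derivative *)

(** Continuous induction from [a]. [G] may jump, but being nondecreasing it jumps upwards only,
    which cannot break the inequality when a supremum is reached from the left; continuity is needed
    of [F] alone. *)
Lemma increment_le (R : realType) (F G : R -> R) (a b : R) :
  a <= b -> {within `[a, b], continuous F} ->
  {in `[a, b] &, {homo G : s t / s <= t}} ->
  (forall t, t \in `]a, b[ -> \forall s \near t^'+, F s - F t <= G s - G t) ->
  F b - F a <= G b - G a.
Proof.
rewrite le_eqVlt => /predU1P[->|ab]; first by rewrite !subrr.
move=> /(continuous_within_itvP _ ab)[Fi Fa Fb] Gnd FG.
(* The slack [e] is spent once, on leaving [a], where no growth comparison is assumed; at later
   points [P] propagates to the right with the same [e]. *)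
apply/ler_addgt0Pr => e e0.
pose P s := F s - F a <= G s - G a + e.
pose S := [set t | a <= t <= b /\ forall s, a <= s <= t -> P s].
have Pa : P a by rewrite /P !subrr add0r ltW.
have Sa : S a.
  split=> [|s]; first by rewrite lexx ltW.
  by rewrite andbC -eq_le => /eqP ->.
have hS : has_sup S by split; [exists a | exists b => t [/andP[]]].
pose tau := sup S.
have atau : a <= tau by apply: ub_le_sup => //; case: hS.
have taub : tau <= b by apply: ge_sup; [exists a | move=> t [/andP[]]].
have Plt s : a <= s -> s < tau -> P s.
  move=> as_ st.
  have [t [_ Pt]] := sup_adherent (eps := tau - s) ltac:(by rewrite subr_gt0) hS.
  by rewrite opprB addrC subrK => s_t; apply: Pt; rewrite as_ ltW.
have Ptau : P tau.
  have [<-//|at_] := eqVneq a tau.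
  have {}at_ : a < tau by rewrite lt_neqAle at_.
  have Fleft : F @ tau^'- --> F tau.
    have [->//|tb] := eqVneq tau b.
    apply/cvg_at_left_filter/Fi.
    by rewrite in_itv/= at_ lt_neqAle tb.
  rewrite /P leNgt; apply/negP => Hlt.
  have Hlt2 : F a + (G tau - G a + e) < F tau by lra.
  have H1 := cvgr_gt _ Fleft (F a + (G tau - G a + e)) Hlt2.
  have H2 := nbhs_left_gt at_.
  have H3 := nbhs_left_lt tau.
  near tau^'- => s.
  have sF : F a + (G tau - G a + e) < F s by near: s; exact: H1.
  have sa : a < s by near: s; exact: H2.
  have st : s < tau by near: s; exact: H3.
  have := Plt _ (ltW sa) st; rewrite /P => Ps.
  have Gs : G s <= G tau.
    apply: Gnd; rewrite ?in_itv/= ?atau ?taub ?(ltW st)//.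
    by rewrite (ltW sa) (le_trans (ltW st)).
  by lra.
have Sle s : a <= s <= tau -> P s.
  by move=> /andP[as_]; rewrite le_eqVlt => /predU1P[->//|]; exact: Plt.
suff <- : tau = b by [].
apply/eqP; rewrite eq_le taub leNgt; apply/negP => tb.
(* If [tau = a], right continuity of [F] keeps it below [F a + e]. If [tau] is interior, the local
   comparison is added to [P tau]. *)
have Pnear : \forall s \near tau^'+, P s.
  have [at_|at_] := eqVneq a tau.
    rewrite -at_ in tb *.
    have Hlt3 : F a < F a + e by lra.
    have H1 := cvgr_lt _ Fa (F a + e) Hlt3.
    have H2 := nbhs_right_le tb.
    have H3 := nbhs_right_ge a.
    near=> s.
    have Hs : F s < F a + e by near: s; exact: H1.
    have sb : s <= b by near: s; exact: H2.
    have as_ : a <= s by near: s; exact: H3.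
    rewrite /P.
    have : G a <= G s by apply: Gnd; rewrite ?in_itv/= ?lexx ?as_ ?ltW.
    by lra.
  have /FG : tau \in `]a, b[ by rewrite in_itv/= tb andbT lt_neqAle at_ atau.
  by apply: filterS => s; move: Ptau; rewrite /P; lra.
have [d /= d0 Pd] := Pnear.
pose u := Num.min b (tau + d / 2).
have tu : tau < u by rewrite lt_min tb ltrDl divr_gt0.
have : S u.
  split=> [|s /andP[as_ su]].
    by rewrite (le_trans atau (ltW tu))/= ge_min lexx.
  have [st|ts] := leP s tau; first by apply: Sle; rewrite as_.
  apply: Pd => //=; rewrite ltr0_norm ?subr_lt0// opprB.
  have : s <= tau + d / 2 by rewrite (le_trans su)// ge_min lexx orbT.
  by lra.
move=> Su; have : u <= tau by apply: ub_le_sup => //; case: hS.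
by rewrite leNgt tu.
Unshelve. all: by end_near. Qed.

(** The derivative is the pointwise limit of the difference quotients with step [1 / (n + 1)].
    Extending [F] by zero makes these measurable on the whole line, and the limit is unaffected,
    since the shifted point eventually lies in the open interval. *)
Lemma measurable_derivative (R : realType) (F D : R -> R) (a b : R) :
  (forall t, t \in `]a, b[ -> is_derive t (1 : R) F (D t)) ->
  measurable_fun `]a, b[ D.
Proof.
move=> FD.
pose G := F \_ `]a, b[.
have mG : measurable_fun setT G.
  apply/(measurable_restrictT _ _).1 => //.
  apply: open_continuous_measurable_fun; first exact: interval_open.
  move=> t; rewrite inE/= => tab; apply: differentiable_continuous.
  by apply/derivable1_diffP; case: (FD _ tab).
pose h n t : R := n.+1%:R * (G (n.+1%:R^-1 + t) - G t).
apply: (@measurable_fun_cvg _ _ _ _ h) => [n|t tab].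
  apply/measurable_funTS/measurable_funM => //.
  apply: measurable_funB => //.
  by apply: measurableT_comp => //; exact: measurable_funD.
have [/cvg_ex[l Fl] lD] := FD _ tab.
have -> : D t = l by rewrite -lD /derive; apply: cvg_lim Fl.
have /cvgr_dnbhsP/(_ harmonic) := Fl.
have hn : harmonic n @[n --> \oo] --> (0 : R) by exact: cvg_harmonic.
move=> /(_ (conj (fun n => lt0r_neq0 (harmonic_gt0 n)) hn)).
apply: cvg_trans; apply: near_eq_cvg => /=.
have Ht : \forall n \near \oo, `]a, b[%classic (harmonic n + t).
  have Hs : (harmonic n + t) @[n --> \oo] --> 0 + t.
    by apply: cvgD => //; exact: cvg_cst.
  apply: Hs; rewrite add0r.
  by apply: open_nbhs_nbhs; split => //; exact: interval_open.
apply: filterS Ht => n Hn.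
by rewrite /h/= invrK/= /G !patchE !mem_set//= scaler1.
Qed.

Lemma near_right_increment_le (R : realType) (F : R -> R) (t D c : R) :
  is_derive t (1 : R) F D -> D < c ->
  \forall s \near t^'+, F s - F t <= c * (s - t).
Proof.
move=> [/cvg_ex[l Fl] lD].
have -> : D = l by rewrite -lD /derive; apply: cvg_lim Fl.
move=> lc; apply/nbhs_right0P.
have /cvgr_lt/(_ _ lc) := cvg_dnbhs_at_right Fl.
move=> Hn; near=> s.
have s0 : 0 < s by [].
have : s^-1 * (F (s *: 1 + t) - F t) < c by near: s; exact: Hn.
by rewrite scaler1 mulrC ltr_pdivrMr// addrC [t + s]addrC addrK addrC => /ltW.
Unshelve. all: by end_near. Qed.

Lemma increment_le_integral (R : realType) (F D h : R -> R) (a b : R) :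
  a <= b -> {within `[a, b], continuous F} ->
  (forall t, t \in `]a, b[ -> is_derive t (1 : R) F (D t)) ->
  measurable_fun `]a, b[ h ->
  (forall t, t \in `]a, b[ -> 0 <= h t) ->
  (forall t, t \in `]a, b[ -> D t <= h t) ->
  ((F b - F a)%:E <= \int[@lebesgue_measure R]_(t in `]a, b[) (h t)%:E)%E.
Proof.
move=> ab Fc FD mh h0 Dh; set mu := @lebesgue_measure R.
apply/lee_addgt0Pr => e e0.
have muS (A B : set R) : measurable A -> measurable B -> A `<=` B ->
    (mu A <= mu B)%E.
  move=> mA mB; apply: (@le_measure _ _ _ (@lebesgue_measure R)); rewrite inE.
    exact: mA.
  exact: mB.
have muU (A B : set R) : measurable A -> measurable B -> A `&` B = set0 ->
    (mu (A `|` B) = mu A + mu B)%E.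
  move=> mA mB; apply: (@measureU _ _ _ (@lebesgue_measure R)).
    exact: mA.
  exact: mB.
(* The error budget is [e = d * (b - a) + d]: the first term pays for rounding [h] up to a multiple
   of [d], the second for replacing the level sets by open sets. The [+ 1] also keeps the
   denominator positive when [a = b]. *)
pose d := e / (b - a + 1).
have ba : 0 < b - a + 1 by lra.
have d0 : 0 < d by rewrite divr_gt0.
have de : d * (b - a) + d = e by rewrite -[X in _ + X]mulr1 -mulrDr divfK// gt_eqF.
pose I := `]a, b[%classic : set R.
have mI : measurable I by exact: measurable_itv.
pose c n : R := n.+1%:R * d.
have c0 n : 0 < c n by rewrite mulr_gt0.
pose E n : set R := I `&` [set t | n%:R * d <= h t < c n].
have Ehd n t : E n t -> c n <= h t + d.
  by move=> [_ /= /andP[+ _]]; rewrite /c -natr1 mulrDl mul1r lerD2r.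
have meh : measurable_fun I (EFin \o h) by exact/measurable_EFinP.
have mE n : measurable (E n).
  have -> : E n = (I `&` [set t | ((n%:R * d)%:E <= (EFin \o h) t)%E])
              `&` (I `&` [set t | ((EFin \o h) t < (c n)%:E)%E]).
    apply/seteqP; split=> t /=.
      by move=> [It /andP[h1 h2]]; rewrite !lee_fin !lte_fin.
    by move=> [[It h1] [_ h2]]; split=> //; apply/andP.
  apply: measurableI.
    exact: emeasurable_fun_c_infty.
  exact: emeasurable_fun_infty_o.
have IE t : I t -> exists n, E n t.
  move=> It; exists (Num.truncn (h t / d)); split=> //=.
  have /truncn_itv : 0 <= h t / d by rewrite divr_ge0 ?h0// ltW.
  by rewrite ler_pdivlMr// ltr_pdivrMr.
have UE : \bigcup_n E n = I.
  apply/seteqP; split=> [t [n _ []]//|t /IE[n En]]; by exists n.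
have tE : trivIset setT E.
  move=> n m _ _ [t [[_ /= /andP[n1 n2]] [_ /= /andP[m1 m2]]]].
  apply/eqP; rewrite eqn_leq; apply/andP; split; rewrite -ltnS.
    by rewrite -(ltr_nat R) -(ltr_pM2r d0) (le_lt_trans n1).
  by rewrite -(ltr_nat R) -(ltr_pM2r d0) (le_lt_trans m1).
have sumE : (\sum_(0 <= n <oo) (c n)%:E * mu (E n) <=
    \int[mu]_(t in I) (h t)%:E + (d * (b - a))%:E)%E.
  have muI : mu I = (b - a)%:E.
    rewrite /mu/I lebesgue_measure_itv/= lte_fin.
    case: ifPn => //; rewrite -leNgt => ba'.
    by rewrite (@le_anti _ _ a b) ?ab// subrr.
  rewrite EFinM -muI -integral_cst// -ge0_integralD//; last first.
    by move=> t It; rewrite lee_fin ltW.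
  rewrite -[X in integral mu X]UE ge0_integral_bigcup//; last 2 first.
  - by rewrite UE; apply: emeasurable_funD => //; exact: measurable_cst.
  - by rewrite UE => t It; rewrite adde_ge0// lee_fin ?h0 ?ltW.
  apply: lee_nneseries => [n _ _|n _]; first by rewrite mule_ge0// lee_fin ltW.
  rewrite -integral_cst; last exact: mE.
  apply: ge0_le_integral => //; first exact: mE.
  - by move=> t _; rewrite lee_fin ltW.
  - apply: emeasurable_funD; last exact: measurable_cst.
    by apply: measurable_funS meh => // t [].
  - by move=> t /Ehd; rewrite /= -EFinD lee_fin.
(* By outer regularity the excess of [U n] can be made so small that, weighted by [c n], it is below
   [d / 2 ^ (n + 1)]; these sum to [d]. *)
have [U HU] : exists U : nat -> set R, forall n, [/\ open (U n), E n `<=` U n &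
    (mu (U n `\` E n) < (d / (2 ^ n.+1)%:R / c n)%:E)%E].
  suff H n : exists V : set R, [/\ open V, E n `<=` V &
      (mu (V `\` E n) < (d / (2 ^ n.+1)%:R / c n)%:E)%E].
    by have [U HU] := choice H; exists U.
  apply: lebesgue_regularity_outer; [exact: mE| |by rewrite !divr_gt0].
  apply: (@le_lt_trans _ _ (mu I)); first by apply: muS => // t [].
  by rewrite /mu/I lebesgue_measure_itv/= lte_fin; case: ifP; rewrite // ltry.
have mU n : measurable (U n) by have [oU _ _] := HU n; exact: open_measurable.
(* [g] is the comparison function and [g' s t] its increment over []s, t]]; half-open intervals make
   the increments additive without overlap. *)
pose g t : \bar R := (\sum_(0 <= n <oo) (c n)%:E * mu (U n `&` `]a, t]))%E.
pose g' s t : \bar R := (\sum_(0 <= n <oo) (c n)%:E * mu (U n `&` `]s, t]))%E.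
have gterm n s t : (0 <= (c n)%:E * mu (U n `&` `]s, t]))%E.
  by rewrite mule_ge0// lee_fin ltW.
have g'0 s t : (0 <= g' s t)%E by apply: nneseries_ge0.
have g0 t : (0 <= g t)%E by apply: nneseries_ge0.
have gb : (g b <= \int[mu]_(t in I) (h t)%:E + e%:E)%E.
  rewrite -de EFinD addeA.
  have H := @epsilon_trick R (fun n => (c n)%:E * mu (E n))%E d xpredT.
  apply: le_trans (le_trans (H _ _) _) => //; last 3 first.
  - by move=> n; rewrite mule_ge0// lee_fin ltW.
  - exact: ltW.
  - exact: leeD2r.
  apply: lee_nneseries => // n _.
  have [oU EU Un] := HU n.
  have -> : (d / (2 ^ n.+1)%:R)%:E = ((c n)%:E * (d / (2 ^ n.+1)%:R / c n)%:E)%E.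
    by rewrite -EFinM mulrCA mulfV ?mulr1// gt_eqF.
  rewrite -ge0_muleDr//; last by rewrite lee_fin !divr_ge0 ?ltW.
  apply: lee_wpmul2l; first by rewrite lee_fin ltW.
  apply: (@le_trans _ _ (mu (E n `|` (U n `\` E n)))).
    apply: muS.
    - exact: measurableI.
    - by apply: measurableU => //; exact: measurableD.
    - by move=> t [Ut _] /=; have [?|?] := pselect (E n t); [left|right].
  rewrite muU//; last 2 first.
  - exact: measurableD.
  - by rewrite setDIK.
  by rewrite leeD2l// ltW.
have gD s t : a <= s -> s <= t -> g t = (g s + g' s t)%E.
  move=> as_ st; rewrite /g -nneseriesD//.
  apply: eq_eseriesr => n _; rewrite -ge0_muleDr//; congr (_ * _)%E.
  rewrite -muU//; last 3 first.
  - exact: measurableI.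
  - exact: measurableI.
  - apply/seteqP; split=> // v [[_ /=]]; rewrite !in_itv/= => /andP[_ vs].
    by move=> [_ /andP[/lt_le_trans/(_ vs)]]; rewrite ltxx.
  rewrite -setIUr; congr (mu (_ `&` _)).
  by rewrite -itv_bndbnd_setU// bnd_simp.
(* The claim is trivial for an infinite integral. Otherwise [g] is finite on [[a, b]], so that its
   real values can be compared with [F]. *)
have [->|Ifin] := eqVneq (\int[mu]_(t in I) (h t)%:E)%E +oo%E.
  by rewrite addye// leey.
have goo : (g b < +oo)%E.
  by rewrite (le_lt_trans gb)// lte_add_pinfty// ?ltry// ltey.
have gfin t : a <= t <= b -> g t \is a fin_num.
  move=> /andP[at_ tb]; rewrite ge0_fin_numE//.
  by rewrite (le_lt_trans _ goo)// (gD t b)// leeDl.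
suff : F b - F a <= fine (g b) - fine (g a).
  move=> FG; apply: le_trans gb; rewrite -[leRHS]fineK ?gfin ?ab ?lexx//.
  by rewrite lee_fin (le_trans FG)// lerBlDr lerDl fine_ge0.
apply: (@increment_le _ F (fine \o g)) => //.
  move=> s t; rewrite !in_itv/= => /andP[as_ sb] /andP[at_ tb] st.
  by rewrite fine_le ?gfin ?as_ ?at_//= (gD s t)// leeDl.
(* At [t] in [E n] the slope of [F] is below [c n], while the open set [U n] contains []t, s]] for
   [s] close to [t]; the [n]-th term of the series alone then contributes [c n * (s - t)]. *)
move=> t tab; have [n En] := IE _ tab.
have [_ /= /andP[_ hc]] := En.
have Dc : D t < c n by rewrite (le_lt_trans _ hc)// Dh.
have [oU EU _] := HU n.
have Ut : nbhs t (U n) by apply: open_nbhs_nbhs; split => //; exact: EU.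
have /andP[at_ tb] : a < t < b by move: tab; rewrite in_itv.
have Fr := near_right_increment_le _ _ _ _ _ (FD _ tab) Dc.
have Ur : \forall s \near t^'+, `]t, s] `<=` U n.
  have [r /= r0 rU] := Ut.
  near=> s; move=> v /=; rewrite in_itv/= => /andP[tv vs].
  apply: rU => /=; rewrite ltr0_norm ?subr_lt0// opprB ltrBlDl.
  by rewrite (le_lt_trans vs)//; near: s; apply: nbhs_right_lt; rewrite ltrDl.
near=> s.
have ts : t < s by [].
have sb : s < b by near: s; exact: nbhs_right_lt.
have Fs : F s - F t <= c n * (s - t) by near: s; exact: Fr.
have Us : `]t, s] `<=` U n by near: s; exact: Ur.
have gst : g s = (g t + g' t s)%E by rewrite -gD// ltW.
have gsf : g s \is a fin_num by rewrite gfin// (ltW sb) (ltW (lt_trans at_ ts)).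
have gtf : g t \is a fin_num by rewrite gfin// !ltW.
have g'ge : ((c n * (s - t))%:E <= g' t s)%E.
  rewrite /g' (nneseriesD1 (n := n))//.
  rewrite EFinM; apply: (@le_trans _ _ ((c n)%:E * mu (U n `&` `]t, s]))%E).
    rewrite (setIidr Us) /mu lebesgue_measure_itv/= lte_fin ts.
    by rewrite EFinB.
  by rewrite leeDl// nneseries_ge0.
apply: (le_trans Fs); rewrite /= -lee_fin EFinB !fineK// leeBrDr//.
by rewrite gst addrC leeD2l.
Unshelve. all: by end_near.
Qed.

(** * Lipschitz constants and Cauchy-Schwarz *)

(** Induction on [p * 'X + c]: the product rule needs a bound on [p], which the inductive Lipschitz
    estimate against the point [0] provides. The absolute value of [M] keeps [k] nonnegative even
    when [M] is negative and the estimate vacuous. *)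
Lemma horner_lipschitz (R : realFieldType) (p : {poly R}) (M : R) :
  exists2 k, 0 <= k & forall u v, `|u| <= M -> `|v| <= M ->
    `|p.[u] - p.[v]| <= k * `|u - v|.
Proof.
elim/poly_ind: p => [|p c [k k0 IH]].
  by exists 0 => // u v _ _; rewrite !horner0 subrr normr0 mul0r.
exists (`|p.[0]| + k * `|M| + `|M| * k) => [|u v uM vM].
  by rewrite !addr_ge0// mulr_ge0.
have M0 : 0 <= M := le_trans (normr_ge0 u) uM.
rewrite !hornerMXaddC opprD addrACA subrr addr0 (ger0_norm M0).
have -> : p.[u] * u - p.[v] * v = p.[u] * (u - v) + (p.[u] - p.[v]) * v by ring.
rewrite [leRHS]mulrDl (le_trans (ler_normD _ _))// lerD// normrM.
  rewrite ler_wpM2r// -[p.[u]](subrK p.[0]) addrC (le_trans (ler_normD _ _))//.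
  have := IH u 0 uM; rewrite normr0 subr0 => /(_ M0) pu.
  by rewrite lerD2l (le_trans pu)// ler_wpM2l.
by rewrite -mulrA [leRHS]mulrC ler_pM ?IH.
Qed.

(** The infimum is attained, as each difference quotient is a lower bound of all admissible
    constants. The given [k] rules out the default value [0] of [inf] on the empty set. *)
Lemma lipschitz_constantP (R : realType) (A : set R) (g : R -> R) (k : R) :
  0 <= k -> k.-lipschitz_A g ->
  0 <= lipschitz_constant A g /\ (lipschitz_constant A g).-lipschitz_A g.
Proof.
move=> k0 kg; set S := [set k | 0 <= k /\ k.-lipschitz_A g].
have Sk : S k by [].
split; first by apply: lb_le_inf; [exists k | move=> l []].
move=> [u v] [Au Av] /=; have [->|uv] := eqVneq u v.
  by rewrite !subrr normr0 mulr0.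
have uv0 : 0 < `|u - v| by rewrite normr_gt0 subr_eq0.
rewrite -ler_pdivrMr//; apply: lb_le_inf; first by exists k.
by move=> l [_ /(_ (u, v))]/= lg; rewrite ler_pdivrMr// lg.
Qed.

(** Cauchy-Schwarz against the indicator of []a, c[], whose norm is the square root of [c - a]. *)
Lemma L1_le_Lpnorm2 (R : realType) (g : R -> R) (a b c : R) :
  a <= c <= b -> measurable_fun `]a, b[ g ->
  (\int[@lebesgue_measure R]_(t in `]a, c[) `|g t|%:E <=
   (Num.sqrt (c - a))%:E * Lpnorm 2%:E a b g)%E.
Proof.
move=> /andP[ac cb] mg.
pose G := g \_ `[a, b].
have mG : measurable_fun setT G.
  apply/(measurable_restrictT _ _).1; first exact: measurable_itv.
  exact: measurable_fun_itv_cc mg.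
pose J := `]a, c[%classic : set R.
have mJ : measurable J by exact: measurable_itv.
have mI : measurable_fun setT (\1_J : R -> R) by exact: measurable_indic.
have := @hoelder _ _ _ (@lebesgue_measure R) G (\1_J) 2 2 mG mI.
have h2 : (2^-1 + 2^-1 = 1 :> R)%R by lra.
move=> /(_ ltac:(by []) ltac:(by []) h2) H.
rewrite muleC.
have <- : ('N[@lebesgue_measure R]_2%:E[EFin \o \1_J] = (Num.sqrt (c - a))%:E)%E.
  have J2 t : `|\1_J t| `^ 2 = \1_J t :> R.
    by rewrite indicE; case: (t \in J); rewrite ?normr1 ?powR1// normr0 powR0.
  rewrite Lnorm.unlock /=; under eq_integral do rewrite J2.
  rewrite integral_indic//= setIT.
  rewrite /J lebesgue_measure_itv/= lte_fin.
  case: ifPn => [ac'|]; first by rewrite -EFinB poweR_EFin powR12_sqrt// subr_ge0.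
  rewrite -leNgt => ca; rewrite (@le_anti _ _ c a) ?ca// subrr sqrtr0.
  by rewrite poweR_EFin powR0.
apply: le_trans H; rewrite Lnorm1 [leLHS]integral_mkcond le_eqVlt; apply/orP; left.
apply/eqP; apply: eq_integral => t _.
rewrite patchE /= indicE.
have [tJ|tJ] := boolP (t \in J); last by rewrite mulr0 normr0.
rewrite mulr1 /G patchE mem_set//=.
move: tJ; rewrite inE/= !in_itv/= => /andP[/ltW -> /ltW tc] /=.
exact: le_trans cb.
Qed.

(** * The error estimate for the two solutions *)

Theorem proposition3p17 (R : realType) (J K : nat) (a b eta : R)
    (f x : R -> R)
    (phi : J.+1.-tuple {poly_J.+1 R}) (psi : K.+1.-tuple {poly_K.+1 R})
    (p : {poly_J.+1 R}) (eps : R) (xhat : R -> R) (beta : R) :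
  a < b ->
  ode_solution f eta a b x ->
  bounded_set (x @` `[a, b]) ->
  basis_of fullv phi ->
  basis_of fullv psi ->
  orthonormal_polys a b psi ->
  \rank (wsindy_mx a b x phi psi) = J.+1 ->
  is_wsindy_approx K a b f x p ->
  0 < eps ->
  (Lpnorm 2%:E a b (fun t => f (x t) - (p : {poly R}).[x t])%R <= eps%:E)%E ->
  ode_solution (fun u => (p : {poly R}).[u]) eta a b xhat ->
  xhat @` `[a, b] `<=` x @` `[a, b] ->
  a <= beta <= b ->
  let L := lipschitz_constant (x @` `[a, beta] `|` xhat @` `[a, beta])
             (fun u => (p : {poly R}).[u]) in
  (beta - a) * L < 1 ->
  (Lpnorm +oo a beta (fun t => x t - xhat t)%R
     <= (Num.sqrt (beta - a) / (1 - (beta - a) * L) * eps)%:E)%E.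
Proof.
move=> ab [xa xc xD] xbd _ _ _ _ _ eps0 gE [ha hc hD] hx /andP[ab' bb] L bL.
pose P u := (p : {poly R}).[u].
pose g t := f (x t) - P (x t).
set A := x @` `[a, beta] `|` xhat @` `[a, beta] in L bL *.
have sub : `[a, beta] `<=` `[a, b].
  by apply: subset_itvl; rewrite bnd_simp.
have [L0 LP] : 0 <= L /\ L.-lipschitz_A P.
  (* Both trajectories stay in the bounded range of [x], where a polynomial is Lipschitz.
     Boundedness gives a bound by every number strictly above [N], hence [N + 1]. *)
  have [N [Nr NP]] := xbd.
  have AN u : A u -> `|u| <= N + 1.
    move=> Au; apply: (NP (N + 1)); first by rewrite ltrDl.
    case: Au => [[t /sub tab <-]|[t /sub tab <-]]; first by exists t.
    by apply: hx; exists t.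
  have [k k0 kP] := horner_lipschitz _ p (N + 1).
  apply: (lipschitz_constantP _ _ _ _ k0).
  by move=> [u v] [/AN ? /AN ?]; exact: kP.
have PxD t : t \in `[a, beta] ->
    `|P (x t) - P (xhat t)| <= L * `|x t - xhat t|.
  by move=> tI; apply: (LP (x t, xhat t)); split; [left|right]; exists t.
pose E t := x t - xhat t.
have Ec : {within `[a, beta], continuous E}.
  move=> t; apply: cvgB.
    exact: (continuous_subspaceW sub xc).
  exact: (continuous_subspaceW sub hc).
have EaD t : t \in `]a, b[ -> is_derive t (1 : R) E (f (x t) - P (xhat t)).
  by move=> tI; apply: is_deriveB; [exact: xD|exact: hD].
have nEc : {within `[a, beta], continuous (fun t => `|E t|)}.
  by move=> t; apply: cvg_norm; exact: Ec.
have [c cI Emax] := EVT_max ab' nEc.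
have /andP[ac cb] : a <= c <= beta by move: cI; rewrite in_itv.
pose M := `|E c|.
have M0 : 0 <= M by exact: normr_ge0.
pose h t := `|g t| + L * M.
have mD : measurable_fun `]a, b[ (fun t => f (x t)).
  by apply: measurable_derivative; exact: xD.
have mg : measurable_fun `]a, b[ g.
  apply: measurable_funB => //.
  apply: measurableT_comp.
    by apply: continuous_measurable_fun; exact: continuous_horner.
  apply: open_continuous_measurable_fun; first exact: interval_open.
  move=> t; rewrite inE/= => tI; apply: differentiable_continuous.
  by apply/derivable1_diffP; case: (xD _ tI).
have subc : `]a, c[ `<=` `]a, b[.
  by apply: subset_itvl; rewrite bnd_simp (le_trans cb).
have mgc : measurable_fun `]a, c[ (fun t => `|g t|).
  apply: measurableT_comp => //.
  exact: measurable_funS mg.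
have mh : measurable_fun `]a, c[ h by apply: measurable_funD.
have Dh t : t \in `]a, c[ -> `|f (x t) - P (xhat t)| <= h t.
  move=> tI.
  have tI' : t \in `[a, beta].
    move: tI; rewrite !in_itv/= => /andP[/ltW -> /ltW tc].
    exact: le_trans cb.
  (* Inserting [P (x t)] splits the derivative of [E] into the residual [g t] and a difference of
     values of [P], controlled by [L * M]. *)
  rewrite -(subrK (P (x t)) (f (x t))) -addrA (le_trans (ler_normD _ _))//.
  rewrite /h lerD2l (le_trans (PxD _ _))// ler_wpM2l//; exact: Emax.
have ME : (M%:E <= \int[@lebesgue_measure R]_(t in `]a, c[) (h t)%:E)%E.
  have E0 : E a = 0 by rewrite /E xa ha subrr.
  have Ecc : {within `[a, c], continuous E}.
    by apply: continuous_subspaceW Ec; apply: subset_itvl; rewrite bnd_simp.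
  have h0 t : t \in `]a, c[ -> 0 <= h t.
    by move=> _; rewrite addr_ge0// mulr_ge0.
  (* The increment bound is one-sided, so it is applied to [E] or to [- E] according to the sign of
     [E c]. *)
  rewrite /M; case: (ger0P (E c)) => _.
    rewrite -[E c]subr0 -E0.
    apply: (increment_le_integral _ E (fun t => f (x t) - P (xhat t)) h) => //.
      by move=> t /subc tI; exact: EaD.
    by move=> t /Dh; apply: le_trans; exact: ler_norm.
  have -> : - E c = (- E) c - (- E) a by rewrite !fctE E0 oppr0 subr0.
  apply: (increment_le_integral _ (- E) (fun t => - (f (x t) - P (xhat t))) h) => //.
  - by move=> t; apply: cvgN; exact: Ecc.
  - by move=> t /subc tI; apply: is_deriveN; exact: EaD.
  - by move=> t /Dh; apply: le_trans; rewrite -normrN ler_norm.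
have MM : M <= Num.sqrt (beta - a) * eps + L * M * (beta - a).
  have mu_c : (@lebesgue_measure R `]a, c[ <= (beta - a)%:E)%E.
    rewrite lebesgue_measure_itv/= lte_fin.
    by case: ifPn => _; rewrite -?EFinB lee_fin ?lerD2r// subr_ge0.
  rewrite -lee_fin (le_trans ME)// EFinD.
  under eq_integral do rewrite EFinD.
  rewrite ge0_integralD//; last 2 first.
  - exact/measurable_EFinP.
  - by move=> t _; rewrite lee_fin mulr_ge0.
  rewrite integral_cst//; apply: leeD.
    have := L1_le_Lpnorm2 _ g a b c; rewrite ac (le_trans cb bb) => /(_ isT mg).
    move/le_trans; apply; rewrite EFinM.
    apply: lee_pmul => //.
    - exact: Lnorm_ge0.
    - by rewrite lee_fin ler_sqrt ?lerD2r ?subr_ge0.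
  rewrite [leRHS]EFinM; apply: lee_wpmul2l; last exact: mu_c.
  by rewrite lee_fin mulr_ge0.
have bL0 : 0 < 1 - (beta - a) * L by rewrite subr_gt0.
(* The term [L * M * (beta - a)] is absorbed into the left side, its coefficient of [M] being less
   than [1]. *)
have Mle : M <= Num.sqrt (beta - a) / (1 - (beta - a) * L) * eps.
  by rewrite mulrAC ler_pdivlMr//; move: MM; lra.
(* The sup norm has default value [0] on a space of measure zero, where nonnegativity of the bound
   suffices. Otherwise the bound holds at every point, the error being extended by zero. *)
rewrite /Lpnorm Lnorm.unlock; case: ifPn => [_|_]; last first.
  rewrite lee_fin mulr_ge0// ?divr_ge0 ?sqrtr_ge0// ltW//.
apply/ess_supP; apply: nearW => t /=; rewrite lee_fin (le_trans _ Mle)//.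
rewrite patchE; case: ifPn => [|_]; last by rewrite normr0.
by rewrite inE/= => tI; exact: Emax.
Qed.
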